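(* For a positive integer $n$, let $\mathrm{XI}_n$ be the graph consisting of two cycles $v_1 v_2 \cdots v_{3n}$ and $u_1 u_2 \cdots u_{3n}$ together with the edges $v_{3i}u_{3i+1}$, $v_{3i+1}u_{3i}$, and $v_{3i+2}u_{3i+2}$ for all $i \in \{0, \dots, n-1\}$, with indices taken modulo $3n$. Then for every positive integer $k$, $\chi'_{\mathrm{irr}}(\mathrm{XI}_{2k}) = 2$ and $\chi'_{\mathrm{irr}}(\mathrm{XI}_{2k+1}) = 3$.
   Context: A graph is locally irregular if no two adjacent vertices have the same degree. A locally irregular edge-coloring of a graph is an (not necessarily proper) edge-coloring such that the edges of each color induce a locally irregular graph; equivalently, for every edge $xy$ of color $i$, the numbers of edges of color $i$ at $x$ and at $y$ differ. $\chi'_{\mathrm{irr}}(G)$ denotes the minimum number of colors in such a coloring of $G$. *)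

(* Defs.v *)
From HB Require Import structures.
From mathcomp Require Import all_boot.

Set Implicit Arguments.
Unset Strict Implicit.
Unset Printing Implicit Defensive.

Record sgraph := SGraph {
  svertex :> finType;
  sadj : rel svertex;
  sadj_sym : symmetric sadj;
  sadj_irr : irreflexive sadj
}.

Definition degree (G : sgraph) (x : G) : nat := #|[set y | sadj x y]|.

Definition locally_irregular (G : sgraph) : Prop :=
  forall x y : G, sadj x y -> degree x <> degree y.

(* An edge is an unordered pair [set x; y] of adjacent vertices. A coloring is
   a function on all vertex sets of which only the values on edges matter. *)
Definition edge_coloring (G : sgraph) := {set G} -> nat.

(* All vertices are kept: those incident with no edge of color i are isolated
   in the color class, which does not affect local irregularity. *)
Definition color_class_adj (G : sgraph) (c : edge_coloring G) (i : nat) : rel G :=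
  fun x y => sadj x y && (c [set x; y] == i).

Lemma color_class_sym (G : sgraph) (c : edge_coloring G) (i : nat) :
  symmetric (color_class_adj c i).
Proof. by move=> x y; rewrite /color_class_adj sadj_sym setUC. Qed.

Lemma color_class_irr (G : sgraph) (c : edge_coloring G) (i : nat) :
  irreflexive (color_class_adj c i).
Proof. by move=> x; rewrite /color_class_adj sadj_irr. Qed.

Definition color_class (G : sgraph) (c : edge_coloring G) (i : nat) : sgraph :=
  SGraph (color_class_sym c i) (color_class_irr c i).

Definition locally_irregular_coloring (G : sgraph) (c : edge_coloring G) : Prop :=
  forall i : nat, locally_irregular (color_class c i).

Definition irr_colorable (G : sgraph) (m : nat) : Prop :=
  exists c : edge_coloring G,
    (forall x y : G, sadj x y -> c [set x; y] < m) /\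
    locally_irregular_coloring c.

(* A relation rather than a function, because some graphs (e.g. K_2) have no
   locally irregular edge-coloring at all. *)
Definition irr_chromatic_index (G : sgraph) (m : nat) : Prop :=
  irr_colorable G m /\ (forall m' : nat, irr_colorable G m' -> m <= m').

(* (false, j) is v_j and (true, j) is u_j, with j an integer modulo 3n in
   {0, ..., 3n - 1}; in particular v_{3n} = v_0 and u_{3n} = u_0. *)
Definition XI_vertex (n : nat) : finType := (bool * 'I_(3 * n))%type.

Definition cyc_adj (N : nat) : rel 'I_N :=
  fun a b => (a.+1 == b %[mod N]) || (b.+1 == a %[mod N]).

(* cross_adj a b: the edge v_a u_b is present. *)
Definition cross_adj (n : nat) : rel 'I_(3 * n) :=
  fun a b => [exists i : 'I_n,
    [|| (a == 3 * i %[mod 3 * n]) && (b == 3 * i + 1 %[mod 3 * n]),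
        (a == 3 * i + 1 %[mod 3 * n]) && (b == 3 * i %[mod 3 * n])
      | (a == 3 * i + 2 %[mod 3 * n]) && (b == 3 * i + 2 %[mod 3 * n])]].

Definition XI_adj (n : nat) : rel (XI_vertex n) :=
  fun p q =>
    match p, q with
    | (false, a), (false, b) | (true, a), (true, b) => cyc_adj a b
    | (false, a), (true, b) => cross_adj a b
    | (true, b), (false, a) => cross_adj a b
    end.

Lemma XI_adj_sym (n : nat) : symmetric (@XI_adj n).
Proof. by move=> [[] a] [[] b] //=; rewrite /cyc_adj orbC. Qed.

Lemma XI_adj_irr (n : nat) : irreflexive (@XI_adj n).
Proof.
have cyc_irr (a : 'I_(3 * n)) : cyc_adj a a = false.
  rewrite /cyc_adj orbb -addn1 -{2}[val a]addn0 eqn_modDl mod0n.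
  by case: n a => [|n] [a lta] //; rewrite modn_small // mulnS.
by move=> [[] a] /=; rewrite cyc_irr.
Qed.

Definition XI (n : nat) : sgraph := SGraph (@XI_adj_sym n) (@XI_adj_irr n).

(* Main.v *)
(* In a coloring of a cubic graph with two colors the irregularity condition
   says that the color-1 degrees of adjacent vertices differ. XI_n is a cyclic
   chain of n blocks of six vertices, so its colorings are the closed walks of
   length n in a finite transition graph on colored blocks. Along a walk with
   two colors a level never increases, and a phase flips at every step that
   keeps the level; a closed walk therefore has even length. Conversely two
   blocks A, B with two colors may alternate, and a block C using a third color
   fits between B and A. *)
Require Import Defs.
From mathcomp Require Import all_boot zify.

Set Implicit Arguments.
Unset Strict Implicit.
Unset Printing Implicit Defensive.

(** * Degrees in color classes and colorings from symmetric functions *)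

Lemma degree_color_class (G : sgraph) (c : edge_coloring G) (i : nat) (x : G)
    (s : seq G) :
  uniq s -> (forall y, sadj x y = (y \in s)) ->
  @degree (color_class c i) x = count_mem i [seq c [set x; y] | y <- s].
Proof.
move=> us adjE; rewrite count_map -size_filter /degree cardsE.
transitivity #|[seq y <- s | c [set x; y] == i]|.
  by apply: eq_card => y; rewrite mem_filter -adjE andbC.
by apply/card_uniqP; rewrite filter_uniq.
Qed.

Lemma set2_inj (T : finType) (x y x' y' : T) :
  [set x; y] = [set x'; y'] -> (x, y) = (x', y') \/ (x, y) = (y', x').
Proof.
move=> E.
have: x \in [set x'; y'] by rewrite -E set21.
have: y \in [set x'; y'] by rewrite -E set22.
have: x' \in [set x; y] by rewrite E set21.
have: y' \in [set x; y] by rewrite E set22.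
by do 4![case/set2P=> ?]; subst; auto.
Qed.

(** The value on a set is read off any pair representing it; only the two orders of a pair give the
    same set, and [col] agrees on them. Other sets get the default 0. *)
Lemma edge_coloring_of_sym (G : sgraph) (col : G -> G -> nat) :
  (forall x y, col x y = col y x) ->
  exists c : edge_coloring G, forall x y, c [set x; y] = col x y.
Proof.
move=> colC.
exists (fun S => if [pick e : G * G | S == [set e.1; e.2]] is Some e
                 then col e.1 e.2 else 0).
move=> x y; case: pickP => [[x' y'] /= /eqP/set2_inj|/(_ (x, y))].
  by case=> -[-> ->].
by rewrite eqxx.
Qed.

(** * Index arithmetic of the rungs *)

(** Index of the other end of the rung at [j], the same from either cycle. Indices are left
    unreduced, so they can be shifted freely by multiples of 3. *)
Definition cross_idx (j : nat) : nat :=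
  match j %% 3 with 0 => j.+1 | 1 => j.-1 | _ => j end.

Lemma cross_idx0 i : cross_idx (3 * i) = (3 * i).+1.
Proof. by rewrite /cross_idx modnMr. Qed.

Lemma cross_idx1 i : cross_idx (3 * i).+1 = 3 * i.
Proof. by rewrite /cross_idx (_ : _ %% 3 = 1) //; lia. Qed.

Lemma cross_idx2 i : cross_idx (3 * i).+2 = (3 * i).+2.
Proof. by rewrite /cross_idx (_ : _ %% 3 = 2) //; lia. Qed.

Definition cross_idxE := (cross_idx0, cross_idx1, cross_idx2).

Variant idx_spec : nat -> Type :=
  | Idx0 i : idx_spec (3 * i)
  | Idx1 i : idx_spec (3 * i).+1
  | Idx2 i : idx_spec (3 * i).+2.

Lemma idxP j : idx_spec j.
Proof.
rewrite (divn_eq j 3) mulnC; have: j %% 3 < 3 by rewrite ltn_mod.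
case: (j %% 3) => [|[|[|r]]] // _; first by rewrite addn0; constructor.
  by rewrite addn1; constructor.
by rewrite addn2; constructor.
Qed.

Lemma cross_idxK : involutive cross_idx.
Proof. by move=> j; case: (idxP j) => i; rewrite !cross_idxE. Qed.

Lemma cross_idxD j q : cross_idx (j + 3 * q) = cross_idx j + 3 * q.
Proof.
by case: (idxP j) => i; rewrite ?addSn -mulnDr !cross_idxE ?addSn -mulnDr.
Qed.

Lemma cross_idx_lt n j : j < 3 * n -> cross_idx j < 3 * n.
Proof. by case: (idxP j) => i; rewrite !cross_idxE; lia. Qed.

Lemma cross_idx_gt2 j : 2 < j -> 2 < cross_idx j.
Proof. by case: (idxP j) => i; rewrite cross_idxE; lia. Qed.

(* The colors of the edges of XI_n with first endpoint in a fixed block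
   {v_(3i), v_(3i+1), v_(3i+2), u_(3i), u_(3i+1), u_(3i+2)}; [v20] and [u20]
   are the edges leading to the next block. *)
Record block := Block {
  v01 : nat; v12 : nat; v20 : nat;
  u01 : nat; u12 : nat; u20 : nat;
  v0u1 : nat; v1u0 : nat; v2u2 : nat
}.

Definition block_colors (t : block) : seq nat :=
  [:: v01 t; v12 t; v20 t; u01 t; u12 t; u20 t; v0u1 t; v1u0 t; v2u2 t].

Definition irr_edge (c : nat) (s s' : seq nat) : bool :=
  count_mem c s != count_mem c s'.

(* [t] may follow [p]: the nine edges leading into or inside [t] satisfy the
   irregularity condition. *)
Definition compat (p t : block) : bool :=
  let pv2 := [:: v12 p; v20 p; v2u2 p] in
  let pu2 := [:: u12 p; u20 p; v2u2 p] in
  let v0 := [:: v20 p; v01 t; v0u1 t] in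
  let u0 := [:: u20 p; u01 t; v1u0 t] in
  let v1 := [:: v01 t; v12 t; v1u0 t] in
  let u1 := [:: u01 t; u12 t; v0u1 t] in
  let v2 := [:: v12 t; v20 t; v2u2 t] in
  let u2 := [:: u12 t; u20 t; v2u2 t] in
  [&& irr_edge (v20 p) pv2 v0, irr_edge (u20 p) pu2 u0,
      irr_edge (v01 t) v0 v1, irr_edge (u01 t) u0 u1,
      irr_edge (v12 t) v1 v2, irr_edge (u12 t) u1 u2,
      irr_edge (v0u1 t) v0 u1, irr_edge (v1u0 t) v1 u0
    & irr_edge (v2u2 t) v2 u2].

(** * Local conditions for indexed colors *)

Section Blocks.

Variables f h : bool -> nat -> nat.

(** Here [f b j] stands for the color of the cycle edge from [j] to [j + 1], and [h b j] for that of
    the rung at [j]. The truncated [j.-1] makes the list meaningful only for [0 < j]. *)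
Definition star (b : bool) (j : nat) : seq nat := [:: f b j.-1; f b j; h b j].

Definition path_ok (b : bool) (j : nat) : bool :=
  irr_edge (f b j) (star b j) (star b j.+1).

Definition cross_ok (j : nat) : bool :=
  irr_edge (h false j) (star false j) (star true (cross_idx j)).

Definition blk (i : nat) : block :=
  Block (f false (3 * i)) (f false (3 * i).+1) (f false (3 * i).+2)
        (f true (3 * i)) (f true (3 * i).+1) (f true (3 * i).+2)
        (h false (3 * i)) (h false (3 * i).+1) (h false (3 * i).+2).

(** [star] reads a rung from both ends, [compat] from a single field; the hypothesis on [h]
    identifies the two readings. *)
Lemma compat_blk i :
  (forall j, h true j = h false (cross_idx j)) ->
  compat (blk i) (blk i.+1) =
  [&& path_ok false (3 * i).+2, path_ok true (3 * i).+2,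
      path_ok false (3 * i.+1), path_ok true (3 * i.+1),
      path_ok false (3 * i.+1).+1, path_ok true (3 * i.+1).+1,
      cross_ok (3 * i.+1), cross_ok (3 * i.+1).+1 & cross_ok (3 * i.+1).+2].
Proof.
move=> hC; have hE := (hC (3 * i.+1), hC (3 * i.+1).+1, hC (3 * i.+1).+2).
have hE2 := hC (3 * i).+2; rewrite !cross_idxE in hE hE2.
have E : 3 * i.+1 = (3 * i).+3 by rewrite mulnS.
rewrite /cross_ok !cross_idxE /blk; rewrite E in hE *.
by rewrite /compat /path_ok /star /= hE2 !hE.
Qed.

(** An edge is tested on the transition into its block, or one transition later if it leads to the
    next block. Block 0 is never entered, hence the bound [2 < j]. *)
Lemma compat_blk_all :
  (forall j, h true j = h false (cross_idx j)) ->
  (forall i, compat (blk i) (blk i.+1)) ->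
  forall j, 2 < j -> (forall b, path_ok b j) /\ cross_ok j.
Proof.
move=> hC ok j; case: (idxP j) => -[|i] // _;
  move: (ok i) (ok i.+1); rewrite !compat_blk //;
  do 2![do 8!case/andP=> ?; move=> ?]; by split=> [[]|].
Qed.

Lemma blk_colors_lt m :
  (forall i, all (gtn m) (block_colors (blk i))) ->
  forall j, (forall b, f b j < m) /\ h false j < m.
Proof.
move=> lt_m j; case: (idxP j) => i; move: (lt_m i) => /=;
  do 9!case/andP=> ?; by split=> [[]|].
Qed.

End Blocks.

(** * Vertices and edges with indices modulo 3n *)

Section Graph.

Variable n : nat.
Hypothesis n_gt0 : 0 < n.

Let N_gt0 : 0 < 3 * n. Proof. by rewrite muln_gt0. Qed.

Definition pt (b : bool) (j : nat) : XI n := (b, Ordinal (ltn_pmod j N_gt0)).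

Lemma pt_eq b b' j j' : (pt b j == pt b' j') = (b == b') && (j == j' %[mod 3 * n]).
Proof. by []. Qed.

Lemma ptD b j : pt b (j + 3 * n) = pt b j.
Proof. by apply/eqP; rewrite pt_eq eqxx modnDr /=. Qed.

Lemma pt_val (x : XI n) : x = pt x.1 x.2.
Proof. by case: x => b j; congr pair; apply: val_inj; rewrite /= modn_small. Qed.

Lemma cross_idx_mod j : cross_idx j = cross_idx (j %% (3 * n)) %[mod 3 * n].
Proof.
rewrite {1}(divn_eq j (3 * n)) addnC mulnCA cross_idxD -mulnCA addnC.
exact: modnMDl.
Qed.

Lemma cross_adjE (a b : 'I_(3 * n)) : cross_adj a b = (b == cross_idx a :> nat).
Proof.
have small (i : 'I_n) r : r < 3 -> (3 * i + r) %% (3 * n) = 3 * i + r.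
  by move=> lt_r; rewrite modn_small //; have := ltn_ord i; lia.
have small0 (i : 'I_n) : (3 * i) %% (3 * n) = 3 * i.
  by rewrite modn_small // ltn_pmul2l.
apply/existsP/eqP => [[i]|ab].
  rewrite !small // !small0 !modn_small // addn1 addn2.
  by case/or3P=> /andP[/eqP-> /eqP->]; rewrite cross_idxE.
have lt_a : a %/ 3 < n by rewrite ltn_divLR // [n * 3]mulnC.
exists (Ordinal lt_a); rewrite !small // !small0 !modn_small // ab /=.
have: a %% 3 < 3 by rewrite ltn_mod.
move: (divn_eq a 3); move: (a %/ 3) (a %% 3) => q r ->; rewrite [q * 3]mulnC.
case: r => [|[|[|r]]] // _.
- by rewrite addn0 cross_idxE addn1 !eqxx.
- by rewrite addn1 cross_idxE !eqxx orbT.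
- by rewrite addn2 cross_idxE !eqxx !orbT.
Qed.

Lemma eqn_modS a b : (a.+1 == b.+1 %[mod 3 * n]) = (a == b %[mod 3 * n]).
Proof. by rewrite -[a.+1]addn1 -[b.+1]addn1 eqn_modDr. Qed.

(** The index [j.+1] avoids taking a predecessor modulo 3n. *)
Lemma pt_nbrs b j y :
  sadj (pt b j.+1) y =
    (y \in [:: pt b j; pt b j.+2; pt (~~ b) (cross_idx j.+1)]).
Proof.
rewrite [in RHS](pt_val y) !inE !pt_eq; case: y => b' l.
have crossE: (l == cross_idx (j.+1 %% (3 * n)) :> nat) =
    (l == cross_idx j.+1 %[mod 3 * n]).
  rewrite cross_idx_mod (modn_small (ltn_ord l)) [cross_idx _ %% _]modn_small //.
  by apply: cross_idx_lt; exact: ltn_pmod.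
have cycE: (l == j %[mod 3 * n]) || (l == j.+2 %[mod 3 * n]) =
   @cyc_adj (3 * n) (Ordinal (ltn_pmod j.+1 N_gt0)) l.
  rewrite /cyc_adj /= modn_mod -(addn1 (_ %% _)) modnDml addn1 orbC.
  by rewrite eqn_modS [in LHS]eq_sym.
case: b; case: b' => //=; rewrite ?orbF ?cycE //.
  rewrite cross_adjE -crossE /=; apply/eqP/eqP => [->|->]; exact/esym/cross_idxK.
by rewrite cross_adjE -crossE.
Qed.

Lemma pt_nbrs_uniq b j :
  uniq [:: pt b j; pt b j.+2; pt (~~ b) (cross_idx j.+1)].
Proof.
(* The two neighbors on the cycle differ because 2 < 3n. *)
have E : (j == j.+2 %[mod 3 * n]) = false.
  by rewrite -[j.+2]addn2 -{1}[j]addn0 eqn_modDl mod0n modn_small //; lia.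
by rewrite /= !inE !pt_eq !eqxx E; case: b.
Qed.

Lemma pt_edge_ind (P : XI n -> XI n -> Prop) :
  (forall x y, P x y -> P y x) ->
  (forall b j, 2 < j -> P (pt b j) (pt b j.+1)) ->
  (forall j, 2 < j -> P (pt false j) (pt true (cross_idx j))) ->
  forall x y, sadj x y -> P x y.
Proof.
move=> PC Ppath Pcross x y.
(* Two shifts by 3n are made because for n = 1 a single one only ensures [2 <= j]. *)
rewrite [x]pt_val -(ptD x.1 x.2) -(ptD x.1); move: x.1 (nat_of_ord x.2) => b l.
have [j -> j_gt2] : exists2 j, l + 3 * n + 3 * n = j.+1 & 2 < j.
  by exists (l + 3 * n + 3 * n).-1; lia.
rewrite pt_nbrs !inE => /or3P[] /eqP->.
- exact/PC/Ppath.
- by apply: Ppath; lia.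
case: b => /=; last by apply: Pcross; lia.
apply: PC; rewrite -{2}[j.+1]cross_idxK; apply: Pcross.
by apply: cross_idx_gt2; lia.
Qed.

(** * From colorings to periodic sequences of blocks *)

Section Coloring.

Variable c : edge_coloring (XI n).

Definition path_edge (b : bool) (j : nat) := c [set pt b j; pt b j.+1].
Definition cross_edge (b : bool) (j : nat) :=
  c [set pt b j; pt (~~ b) (cross_idx j)].

Lemma cross_edge_sym j : cross_edge true j = cross_edge false (cross_idx j).
Proof. by rewrite /cross_edge cross_idxK setUC. Qed.

Lemma degree_pt i b j : 0 < j ->
  @degree (color_class c i) (pt b j) =
  count_mem i (star path_edge cross_edge b j).
Proof.
case: j => // j _; rewrite (degree_color_class _ _ (pt_nbrs_uniq b j)).
  by rewrite /star /path_edge [in RHS]setUC.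
exact: pt_nbrs.
Qed.

Lemma sadj_path b j : sadj (pt b j) (pt b j.+1).
Proof. by rewrite sadj_sym pt_nbrs inE eqxx. Qed.

Lemma sadj_cross b j : sadj (pt b j) (pt (~~ b) (cross_idx j)).
Proof.
rewrite -(ptD b j) -(ptD _ (cross_idx j)) -cross_idxD.
have [l ->] : exists l, j + 3 * n = l.+1.
  by exists (j + 3 * n).-1; lia.
by rewrite pt_nbrs !inE eqxx !orbT.
Qed.

(** Every edge has a representative with index above 2, so the transitions between consecutive
    blocks test all edges, including those of block 0. *)
Lemma irr_coloring_compat :
  locally_irregular_coloring c <->
  forall i, compat (blk path_edge cross_edge i) (blk path_edge cross_edge i.+1).
Proof.
split=> [irr i | ok i x y /andP[xy cxy]].
  have pathP b j : 0 < j -> path_ok path_edge cross_edge b j.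
    move=> j_gt0; apply/eqP; rewrite -!degree_pt //; apply: irr.
    by apply/andP; split; [exact: sadj_path | rewrite /path_edge].
  have crossP j : 0 < j -> 0 < cross_idx j -> cross_ok path_edge cross_edge j.
    move=> j_gt0 j'_gt0; apply/eqP; rewrite -!degree_pt //; apply: irr.
    by apply/andP; split; [exact: (sadj_cross false) | rewrite /cross_edge].
  rewrite compat_blk; last exact: cross_edge_sym.
  by rewrite !pathP ?crossP // cross_idxE.
have {}ok := compat_blk_all cross_edge_sym ok.
pose irr x y := c [set x; y] == i ->
  @degree (color_class c i) x <> @degree (color_class c i) y.
apply: (pt_edge_ind (P := irr)) xy cxy => [x' y' IH|b j j_gt2|j j_gt2]; rewrite /irr.
- by rewrite setUC => /IH; apply: nesym.
- move=> /eqP <-; rewrite !degree_pt; try lia.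
  by case: (ok j j_gt2) => /(_ b)/eqP.
- move=> /eqP <-; rewrite !degree_pt; try lia.
    by case: (ok j j_gt2) => _ /eqP.
  by have := cross_idx_gt2 j_gt2; lia.
Qed.

Lemma coloring_lt_blk m :
  (forall x y, sadj x y -> c [set x; y] < m) <->
  forall i, all (gtn m) (block_colors (blk path_edge cross_edge i)).
Proof.
split=> [lt_m i|/blk_colors_lt lt_m].
  have lt_path b j : path_edge b j < m by apply/lt_m/sadj_path.
  have lt_cross b j : cross_edge b j < m by apply/lt_m/sadj_cross.
  by rewrite /= !lt_path !lt_cross.
apply: (pt_edge_ind (P := fun x y => c [set x; y] < m)) => [x y|b j _|j _].
- by rewrite setUC.
- by case: (lt_m j) => /(_ b).
- by case: (lt_m j).
Qed.

Lemma blk_periodic i :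
  blk path_edge cross_edge (i + n) = blk path_edge cross_edge i.
Proof.
have pathE b j : path_edge b (j + 3 * n) = path_edge b j.
  by rewrite /path_edge -addSn !ptD.
have crossE b j : cross_edge b (j + 3 * n) = cross_edge b j.
  by rewrite /cross_edge cross_idxD !ptD.
by rewrite /blk mulnDr -!addSn !pathE !crossE.
Qed.

End Coloring.

(** * From periodic sequences of blocks to colorings *)

(** The default value of [nth] is the entry for [r = 2]; likewise in [cross_color]. *)
Definition path_color (t : block) (b : bool) (r : nat) : nat :=
  nth (if b then u20 t else v20 t)
      (if b then [:: u01 t; u12 t] else [:: v01 t; v12 t]) r.

Definition cross_color (t : block) (r : nat) : nat :=
  nth (v2u2 t) [:: v0u1 t; v1u0 t] r.

Lemma coloring_of_blocks (B : nat -> block) :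
  (forall i, B (i + n) = B i) ->
  exists c, forall i, blk (path_edge c) (cross_edge c) i = B i.
Proof.
move=> B_per.
pose f b j := path_color (B (j %/ 3)) b (j %% 3).
pose g j := cross_color (B (j %/ 3)) (j %% 3).
pose h b j := g (if b then cross_idx j else j).
have divD j : (j + 3 * n) %/ 3 = j %/ 3 + n by rewrite divnDr ?dvdn_mulr // mulKn.
have modD j : (j + 3 * n) %% 3 = j %% 3 by rewrite mulnC addnC modnMDl.
have per_mod (F : nat -> nat) j :
    (forall j, F (j + 3 * n) = F j) -> F (j %% (3 * n)) = F j.
  move=> F_per; rewrite {2}(divn_eq j (3 * n)) addnC.
  elim: (j %/ (3 * n)) => [|q IH]; first by rewrite addn0.
  by rewrite [q.+1 * _]mulSnr addnA F_per.
have f_per b j : f b (j %% (3 * n)) = f b j.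
  by apply: per_mod => {}j; rewrite /f divD modD B_per.
have h_per b j : h b (j %% (3 * n)) = h b j.
  apply: per_mod => {}j; rewrite /h /g.
  by case: b; rewrite ?cross_idxD divD modD B_per.
have hC b j : h (~~ b) (cross_idx j) = h b j by case: b; rewrite /h //= cross_idxK.
pose nx (x : XI n) := pt x.1 x.2.+1.
pose cr (x : XI n) := pt (~~ x.1) (cross_idx x.2).
have nx_pt b j : nx (pt b j) = pt b j.+1.
  by apply/eqP; rewrite pt_eq eqxx eqn_modS modn_mod /=.
have cr_pt b j : cr (pt b j) = pt (~~ b) (cross_idx j).
  by apply/eqP; rewrite pt_eq eqxx -cross_idx_mod /=.
have crK : involutive cr.
  by move=> x; rewrite [x]pt_val !cr_pt negbK cross_idxK.
(* At most one indicator is nonzero: a rung changes cycle, and 3n > 2 excludes that [x] and [y] each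
   follow the other. On an edge the sum is thus its intended color. *)
pose col (x y : XI n) :=
  (y == nx x) * f x.1 x.2 + (x == nx y) * f y.1 y.2 + (y == cr x) * h x.1 x.2.
have colC x y : col x y = col y x.
  rewrite /col [_ * _ + _]addnC; congr (_ + _).
  rewrite [x == cr y]eq_sym (can2_eq crK crK).
  by case: eqP => // ->; rewrite /cr /= h_per hC.
have [c cE] := edge_coloring_of_sym colC; exists c.
have pathE b j : path_edge c b j = f b j.
  rewrite /path_edge cE /col !nx_pt cr_pt /= f_per eqxx mul1n.
  have := pt_nbrs_uniq b j; rewrite /= inE negb_or -andbA => /and3P[/negPf-> _ _].
  by rewrite pt_eq; case: b; rewrite /= !addn0.
have crossE b j : cross_edge c b j = h b j.
  rewrite /cross_edge cE /col !nx_pt cr_pt /= h_per eqxx mul1n.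
  by rewrite !pt_eq; case: b.
move=> i; rewrite /blk !pathE !crossE /f /h /g.
have divE r : r < 3 -> (3 * i + r) %/ 3 = i /\ (3 * i + r) %% 3 = r.
  by move=> r_lt3; rewrite mulnC divnMDl // modnMDl divn_small // modn_small ?addn0.
have [d1 m1] := divE 1 isT; have [d2 m2] := divE 2 isT.
rewrite addn1 in d1 m1; rewrite addn2 in d2 m2.
by rewrite mulKn // modnMr d1 m1 d2 m2; case: (B i).
Qed.

Lemma XI_colorableP m :
  irr_colorable (XI n) m <->
  exists B : nat -> block,
    [/\ forall i, B (i + n) = B i,
        forall i, all (gtn m) (block_colors (B i))
      & forall i, compat (B i) (B i.+1)].
Proof.
split=> [[c [/coloring_lt_blk c_lt /irr_coloring_compat c_irr]]|].
  by exists (blk (path_edge c) (cross_edge c)); split=> // i; exact: blk_periodic.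
case=> B [B_per B_lt B_ok]; have [c cE] := coloring_of_blocks B_per.
exists c; split; first by apply/coloring_lt_blk => i; rewrite cE.
by apply/irr_coloring_compat => i; rewrite !cE.
Qed.

End Graph.

(** * The parity obstruction for two colors *)

(* For blocks with colors 0 and 1, [vdeg] and [udeg] are the numbers of edges
   of color 1 at the last two vertices of the block. *)
Definition vdeg (t : block) : nat := v12 t + v20 t + v2u2 t.
Definition udeg (t : block) : nat := u12 t + u20 t + v2u2 t.

(* The transition graph on the pairs of last vertices has three strongly
   connected components, all bipartite: [level] ranks the components and
   [phase] is the bipartition. Level 3 collects the blocks that cannot occur,
   since the rung edge already violates irregularity. *)
Definition level (t : block) : nat :=
  let d := vdeg t + udeg t in
  if vdeg t == udeg t then 3
  else if odd d then (if (v20 t == u20 t) == (d == 3) then 2 else 0) else 1.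

Definition phase (t : block) : bool :=
  let d := vdeg t + udeg t in if odd d then v20 t != u20 t else d == 2.

(** Boolean quantification over the colors 0 and 1, so that a finite check can be evaluated. *)
Definition all2 (P : pred nat) : bool := P 0 && P 1.

Lemma all2P (P : pred nat) : all2 P -> forall d, d < 2 -> P d.
Proof. by case/andP=> P0 P1 [|[|d]]. Qed.

Lemma compat_level p t :
  all (gtn 2) (block_colors p) -> all (gtn 2) (block_colors t) -> compat p t ->
  (level t <= level p) && ((level t == level p) ==> (phase t == ~~ phase p)).
Proof.
case: p t => p0 p1 p2 p3 p4 p5 p6 p7 p8 [t0 t1 t2 t3 t4 t5 t6 t7 t8] /=.
move=> /andP[_ /and5P[hp1 hp2 _ hp4 /and5P[hp5 _ _ hp8 _]]].
move=> /andP[ht0 /and5P[ht1 ht2 ht3 ht4 /and5P[ht5 ht6 ht7 ht8 _]]]; apply/implyP.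
(* The claim sees [p] only through the five edges at its last two vertices. With the nine colors of
   [t] this leaves 2^14 cases, settled by computation. *)
suff: all2 (fun p1 => all2 (fun p2 => all2 (fun p4 => all2 (fun p5 =>
  all2 (fun p8 => all2 (fun t0 => all2 (fun t1 => all2 (fun t2 =>
  all2 (fun t3 => all2 (fun t4 => all2 (fun t5 => all2 (fun t6 =>
  all2 (fun t7 => all2 (fun t8 =>
    let p := Block p0 p1 p2 p3 p4 p5 p6 p7 p8 in
    let t := Block t0 t1 t2 t3 t4 t5 t6 t7 t8 in
    compat p t ==> (level t <= level p) &&
      ((level t == level p) ==> (phase t == ~~ phase p)))))))))))))))).
  by move=> /all2P/(_ _ hp1)/all2P/(_ _ hp2)/all2P/(_ _ hp4)/all2P/(_ _ hp5)
    /all2P/(_ _ hp8)/all2P/(_ _ ht0)/all2P/(_ _ ht1)/all2P/(_ _ ht2)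
    /all2P/(_ _ ht3)/all2P/(_ _ ht4)/all2P/(_ _ ht5)/all2P/(_ _ ht6)
    /all2P/(_ _ ht7)/all2P/(_ _ ht8).
by vm_compute.
Qed.

Lemma XI_odd_not_2colorable n : odd n -> ~ irr_colorable (XI n) 2.
Proof.
move=> n_odd; have n_gt0 : 0 < n by case: n n_odd.
move/(XI_colorableP n_gt0) => [B [B_per B_lt B_ok]].
have step i : level (B i.+1) <= level (B i) /\
    (level (B i.+1) = level (B i) -> phase (B i.+1) = ~~ phase (B i)).
  have /andP[le_lev eq_lev] := compat_level (B_lt i) (B_lt i.+1) (B_ok i).
  by split=> // /eqP E; apply/eqP; rewrite E in eq_lev.
have level_mono i j : level (B (i + j)) <= level (B i).
  elim: j => [|j IH]; first by rewrite addn0.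
  by rewrite addnS; apply: leq_trans IH; case: (step (i + j)).
(* Going once around the cycle returns to the same level, so no step can lower it. *)
have level_const i : level (B i.+1) = level (B i).
  apply/eqP; rewrite eqn_leq (step i).1 /= -{1}(B_per i).
  by rewrite -(prednK n_gt0) addnS -addSn level_mono.
have phaseE i : phase (B i) = phase (B 0) (+) odd i.
  elim: i => [|i IH]; first by rewrite addbF.
  by rewrite (step i).2 // IH /= addbN.
(* Periodicity gives [B n] the phase of [B 0], but an odd number of flips reverses it. *)
by have := phaseE n; rewrite n_odd -{1}[n]add0n B_per; case: (phase _).
Qed.

(** With a single color the class is the whole cubic graph, where adjacent vertices have equal
    degree. *)
Lemma XI_colorable_ge2 n m : 0 < n -> irr_colorable (XI n) m -> 2 <= m.
Proof.
move=> n_gt0 /(XI_colorableP n_gt0)[B [_ B_lt B_ok]].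
rewrite leqNgt; apply/negP => m_lt2.
have const i : B i = Block 0 0 0 0 0 0 0 0 0.
  case: (B i) (B_lt i) => a0 a1 a2 a3 a4 a5 a6 a7 a8 /=.
  do 8!case/andP=> ?; case/andP=> ? _.
  by congr Block; lia.
by have := B_ok 0; rewrite !const.
Qed.

(** * Explicit colorings *)

(** [blkA] and [blkB] both have level 2 and opposite phases. In [blkC] the color 2 forms a path of
    two edges, from [u_(3i+1)] to the next block. *)
Definition blkA := Block 1 1 0 0 0 0 0 1 1.
Definition blkB := Block 0 1 0 0 1 1 0 0 1.
Definition blkC := Block 0 0 0 0 2 2 0 1 0.

Lemma XI_even_2colorable k : 0 < k -> irr_colorable (XI (2 * k)) 2.
Proof.
move=> k_gt0; apply/XI_colorableP; first by rewrite muln_gt0.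
exists (fun i => if odd i then blkA else blkB); split=> i.
- by rewrite oddD oddM addbF.
- by case: (odd i).
- by rewrite /=; case: (odd i).
Qed.

Lemma XI_odd_3colorable k : 0 < k -> irr_colorable (XI (2 * k + 1)) 3.
Proof.
move=> k_gt0; have n_gt0 : 0 < 2 * k + 1 by rewrite addn1.
apply/(XI_colorableP n_gt0).
pose B r := if r == 0 then blkC else if odd r then blkA else blkB.
exists (fun i => B (i %% (2 * k + 1))); split=> i.
- by rewrite modnDr.
- by rewrite /B; case: ifP => // _; case: ifP.
rewrite -[i.+1]addn1 -modnDml; have := ltn_pmod i n_gt0.
move: (i %% _) => r; rewrite addn1 ltnS leq_eqVlt => /orP[/eqP->|r_lt].
  (* The last index 2k is even and nonzero, so it carries [blkB], and the walk closes by the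
     transition from [blkB] to [blkC]. *)
  by rewrite addn1 modnn /B oddM /= muln_eq0 /= eqn0Ngt k_gt0.
rewrite modn_small ?addn1 ?ltnS // /B /=.
by case: r {r_lt} => [|r] //=; case: (odd r).
Qed.

Theorem theorem9 (k : nat) (hk : 0 < k) :
  irr_chromatic_index (XI (2 * k)) 2 /\
  irr_chromatic_index (XI (2 * k + 1)) 3.
Proof.
split; split.
- exact: XI_even_2colorable.
- by move=> m; apply: XI_colorable_ge2; rewrite muln_gt0.
- exact: XI_odd_3colorable.
move=> m m_col; have: 2 <= m by apply: XI_colorable_ge2 m_col; rewrite addn1.
rewrite leq_eqVlt => /orP[/eqP m2|//]; rewrite -m2 in m_col.
by case: (XI_odd_not_2colorable _ m_col); rewrite oddD oddM.
Qed.
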